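(* Let $k$ be an algebraically closed field (of arbitrary characteristic) and let $A$ be a finite-dimensional $k$-algebra of finite representation type. Then the Lie algebra $\mathrm{HH}^1_{\mathrm{rad}}(A)$ is solvable.
   Context: $\mathrm{Der}_{\mathrm{rad}}(A)$ is the Lie algebra (under the commutator) of $k$-linear derivations $\delta$ of $A$ with $\delta(\mathrm{rad}(A))\subseteq\mathrm{rad}(A)$, where $\mathrm{rad}(A)$ is the Jacobson radical; $\mathrm{Inn}(A)=\{[a,-]:a\in A\}$ is the Lie ideal of inner derivations; $\mathrm{HH}^1_{\mathrm{rad}}(A)=\mathrm{Der}_{\mathrm{rad}}(A)/\mathrm{Inn}(A)$. *)

(* Defs.v *)
From HB Require Import structures.
From mathcomp Require Import all_boot all_algebra all_field.
From mathcomp Require Import boolp.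

Set Implicit Arguments.
Unset Strict Implicit.
Unset Printing Implicit Defensive.

Import GRing.Theory.
Local Open Scope ring_scope.
Local Open Scope quotient_scope.

HB.mixin Record Lmodule_isLie (k : fieldType) L of GRing.Lmodule k L := {
  lie : L -> L -> L;
  lie_linearl : forall z : L, linear (fun x => lie x z);
  lie_linearr : forall x : L, linear (lie x);
  liexx : forall x : L, lie x x = 0;
  lie_jacobi : forall x y z : L,
    lie x (lie y z) + lie y (lie z x) + lie z (lie x y) = 0
}.

#[short(type="lieAlgType")]
HB.structure Definition LieAlgebra (k : fieldType) :=
  { L of Lmodule_isLie k L & GRing.Lmodule k L }.

Reserved Notation "[ 'lie' x , y ]" (format "[ 'lie'  x ,  y ]").
Notation "[ 'lie' x , y ]" := (lie x y) : ring_scope.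

Section LieTheory.
Variables (k : fieldType) (L : lieAlgType k).
Implicit Types x y z : L.

Lemma lieDl x y z : [lie x + y, z] = [lie x, z] + [lie y, z].
Proof. by have := lie_linearl z 1 x y; rewrite !scale1r. Qed.

Lemma lieDr x y z : [lie x, y + z] = [lie x, y] + [lie x, z].
Proof. by have := lie_linearr x 1 y z; rewrite !scale1r. Qed.

Lemma lie0l x : [lie 0, x] = 0.
Proof. by apply: (addrI [lie 0, x]); rewrite -lieDl !addr0. Qed.

Lemma lie0r x : [lie x, 0] = 0.
Proof. by apply: (addrI [lie x, 0]); rewrite -lieDr !addr0. Qed.

Lemma lieZl a x y : [lie a *: x, y] = a *: [lie x, y].
Proof. by have := lie_linearl y a x 0; rewrite lie0l !addr0. Qed.

Lemma lieZr a x y : [lie x, a *: y] = a *: [lie x, y].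
Proof. by have := lie_linearr x a y 0; rewrite lie0r !addr0. Qed.

Lemma lieNl x y : [lie - x, y] = - [lie x, y].
Proof. by rewrite -scaleN1r lieZl scaleN1r. Qed.

Lemma lieNr x y : [lie x, - y] = - [lie x, y].
Proof. by rewrite -scaleN1r lieZr scaleN1r. Qed.

Lemma lieC x y : [lie y, x] = - [lie x, y].
Proof.
apply/eqP; rewrite -addr_eq0 addrC; apply/eqP.
by have := liexx (x + y); rewrite lieDl !lieDr !liexx add0r addr0.
Qed.

Definition lie_derived (S : L -> Prop) : L -> Prop := fun z =>
  exists (n : nat) (c : 'I_n -> k) (x y : 'I_n -> L),
    (forall i, S (x i) /\ S (y i)) /\ z = \sum_i c i *: [lie x i, y i].

Definition derived_series (n : nat) : L -> Prop :=
  iter n lie_derived (fun=> True).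

Definition lie_solvable : Prop :=
  exists n : nat, forall z, derived_series n z -> z = 0.

End LieTheory.

Arguments lie_solvable {k} L.

(* Left stability suffices, since the bracket is alternating. *)
Record lieIdeal (k : fieldType) (L : lieAlgType k) := LieIdeal {
  lie_ideal :> {pred L};
  lie_ideal_submod : GRing.submod_closed lie_ideal;
  lie_stable : forall x y : L, y \in lie_ideal -> [lie x, y] \in lie_ideal
}.

HB.instance Definition _ (k : fieldType) (L : lieAlgType k) (I : lieIdeal L) :=
  GRing.isSubmodClosed.Build k L (lie_ideal I) (lie_ideal_submod I).

Section LieQuotient.
Variables (k : fieldType) (L : lieAlgType k) (I : lieIdeal L).

Definition lie_quot : Type := {ideal_quot lie_ideal I}.

HB.instance Definition _ := GRing.Zmodule.on lie_quot.
HB.instance Definition _ := EqQuotient.on lie_quot.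

Lemma lie_quotW (P : lie_quot -> Prop) :
  (forall x : L, P (\pi_lie_quot x)) -> forall u, P u.
Proof. exact: quotW. Qed.

Lemma lie_quot_eqP (x y : L) :
  reflect (\pi_lie_quot x = \pi_lie_quot y) (x - y \in I).
Proof. by rewrite Quotient.idealrBE; apply: eqP. Qed.

Lemma lie_quot_repr (x : L) : repr (\pi_lie_quot x) - x \in I.
Proof. by apply/lie_quot_eqP; rewrite reprK. Qed.

Lemma lie_quot_piD (x y : L) :
  \pi_lie_quot (x + y) = \pi_lie_quot x + \pi_lie_quot y.
Proof. exact: (Quotient.pi_add I). Qed.

Definition lie_quot_scale (a : k) (u : lie_quot) : lie_quot :=
  \pi_lie_quot (a *: repr u).

Definition lie_quot_lie (u v : lie_quot) : lie_quot :=
  \pi_lie_quot [lie repr u, repr v].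

Lemma lie_quot_scaleE a x :
  lie_quot_scale a (\pi_lie_quot x) = \pi_lie_quot (a *: x).
Proof.
by apply/lie_quot_eqP; rewrite -scalerBr rpredZ // lie_quot_repr.
Qed.

Lemma lie_quot_lieE x y :
  lie_quot_lie (\pi_lie_quot x) (\pi_lie_quot y) = \pi_lie_quot [lie x, y].
Proof.
apply/lie_quot_eqP; set x' := repr _; set y' := repr _.
have -> : [lie x', y'] - [lie x, y] = [lie x', y' - y] - [lie y, x' - x].
  by rewrite !lieDr !lieNr ![[lie y, _]]lieC !opprK opprD opprK addrA subrK.
by rewrite rpredB // lie_stable // lie_quot_repr.
Qed.

Fact lie_quot_scalerA a b u :
  lie_quot_scale a (lie_quot_scale b u) = lie_quot_scale (a * b) u.
Proof. by elim/lie_quotW: u => x; rewrite !lie_quot_scaleE scalerA. Qed.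

Fact lie_quot_scale1r : left_id 1 lie_quot_scale.
Proof. by move=> u; elim/lie_quotW: u => x; rewrite lie_quot_scaleE scale1r. Qed.

Fact lie_quot_scalerDr : right_distributive lie_quot_scale +%R.
Proof.
move=> a u v; elim/lie_quotW: u => x; elim/lie_quotW: v => y.
by rewrite -lie_quot_piD !lie_quot_scaleE scalerDr lie_quot_piD.
Qed.

Fact lie_quot_scalerDl u : {morph lie_quot_scale^~ u : a b / a + b}.
Proof.
by elim/lie_quotW: u => x a b; rewrite !lie_quot_scaleE scalerDl lie_quot_piD.
Qed.

HB.instance Definition _ := GRing.Zmodule_isLmodule.Build k lie_quot
  lie_quot_scalerA lie_quot_scale1r lie_quot_scalerDr lie_quot_scalerDl.

Lemma lie_quot_piZ a (x : L) : \pi_lie_quot (a *: x) = a *: \pi_lie_quot x.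
Proof. by rewrite -lie_quot_scaleE. Qed.

Fact lie_quot_linearl w : linear (fun u => lie_quot_lie u w).
Proof.
move=> a u v; elim/lie_quotW: u => x; elim/lie_quotW: v => y; elim/lie_quotW: w => z.
rewrite -lie_quot_piZ -lie_quot_piD !lie_quot_lieE lieDl lieZl.
by rewrite lie_quot_piD lie_quot_piZ.
Qed.

Fact lie_quot_linearr w : linear (lie_quot_lie w).
Proof.
move=> a u v; elim/lie_quotW: u => x; elim/lie_quotW: v => y; elim/lie_quotW: w => z.
rewrite -lie_quot_piZ -lie_quot_piD !lie_quot_lieE lieDr lieZr.
by rewrite lie_quot_piD lie_quot_piZ.
Qed.

Fact lie_quot_liexx u : lie_quot_lie u u = 0.
Proof.
elim/lie_quotW: u => x; rewrite lie_quot_lieE liexx.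
exact: (@pi_zeror _ _ _ _ _ {ideal_quot lie_ideal I}).
Qed.

Fact lie_quot_jacobi u v w :
  lie_quot_lie u (lie_quot_lie v w) + lie_quot_lie v (lie_quot_lie w u)
    + lie_quot_lie w (lie_quot_lie u v) = 0.
Proof.
elim/lie_quotW: u => x; elim/lie_quotW: v => y; elim/lie_quotW: w => z.
by rewrite !lie_quot_lieE -!lie_quot_piD lie_jacobi -(liexx x) -lie_quot_lieE
   lie_quot_liexx.
Qed.

HB.instance Definition _ := Lmodule_isLie.Build k lie_quot
  lie_quot_linearl lie_quot_linearr lie_quot_liexx lie_quot_jacobi.

End LieQuotient.

Section Radical.
Variables (k : fieldType) (A : falgType k).

(* The submodules of the regular left module A^o are the left ideals of A. *)
Definition maximal_left_ideal (I : submodClosed A^o) : Prop :=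
  (1 : A^o) \notin I /\
  forall J : submodClosed A^o,
    {subset I <= J} -> (1 : A^o) \notin J -> {subset J <= I}.

Definition jacobson_radical (x : A) : Prop :=
  forall I : submodClosed A^o, maximal_left_ideal I -> (x : A^o) \in I.

End Radical.

Section Derivations.
Variables (k : fieldType) (A : falgType k).

Definition der_rad : {pred 'End(A)} := fun d =>
  `[< (forall x y : A, d (x * y) = d x * y + x * d y) /\
      (forall x : A, jacobson_radical x -> jacobson_radical (d x)) >].

Definition inner_der : {pred 'End(A)} := fun d =>
  `[< exists a : A, forall x : A, d x = a * x - x * a >].

Lemma der_radP (d : 'End(A)) :
  reflect ((forall x y : A, d (x * y) = d x * y + x * d y) /\
           (forall x : A, jacobson_radical x -> jacobson_radical (d x)))
          (d \in der_rad).
Proof. exact: asboolP. Qed.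

Lemma inner_derP (d : 'End(A)) :
  reflect (exists a : A, forall x : A, d x = a * x - x * a) (d \in inner_der).
Proof. exact: asboolP. Qed.

Lemma jacobson_radical0 : jacobson_radical (0 : A).
Proof. by move=> I _; apply: rpred0. Qed.

Lemma jacobson_radicalD (x y : A) :
  jacobson_radical x -> jacobson_radical y -> jacobson_radical (x + y).
Proof. by move=> Jx Jy I mI; apply: rpredD; [apply: Jx | apply: Jy]. Qed.

Lemma jacobson_radicalMl (a x : A) :
  jacobson_radical x -> jacobson_radical (a * x).
Proof.
by move=> Jx I mI; have := Jx I mI; apply: (@rpredZ _ _ I a (x : A^o)).
Qed.

Lemma jacobson_radicalN (x : A) :
  jacobson_radical x -> jacobson_radical (- x).
Proof. by rewrite -mulN1r; apply: jacobson_radicalMl. Qed.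

Lemma jacobson_radicalZ (c : k) (x : A) :
  jacobson_radical x -> jacobson_radical (c *: x).
Proof. by move/(jacobson_radicalMl c%:A); rewrite -scalerAl mul1r. Qed.

Section Transporter.
Variables (I : submodClosed A^o) (a : A).

Definition transporter : {pred A^o} := fun y => ((y : A) * a : A^o) \in I.

Fact transporter_submod : GRing.submod_closed transporter.
Proof.
split=> [|b u v uI vI]; rewrite /transporter unfold_in /=.
  by rewrite mul0r rpred0.
rewrite (mulrDl (b * u : A) v a) rpredD // -mulrA.
exact: (@rpredZ _ _ I b ((u : A) * a : A^o)).
Qed.

HB.instance Definition _ :=
  GRing.isSubmodClosed.Build A A^o transporter transporter_submod.

Lemma transporter_maximal :
  maximal_left_ideal I -> (a : A^o) \notin I ->
  maximal_left_ideal (transporter : submodClosed A^o).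
Proof.
move=> [_ maxI] aI; split=> [|J IJ J1 y yJ].
  by rewrite unfold_in /= mul1r.
rewrite unfold_in /=; apply/negP => /negP yaI; case/negP: J1.
pose K : {pred A^o} := fun z =>
  `[< exists m b : A, (m : A^o) \in I /\ (z : A) = m + b * ((y : A) * a) >].
have KP z : reflect (exists m b : A, (m : A^o) \in I /\ z = m + b * (y * a))
                    (z \in K) by apply: asboolP.
have Ksub : GRing.submod_closed K.
  split; first by apply/KP; exists 0, 0; rewrite mul0r addr0 rpred0.
  move=> c u v /KP[m [b [mI ->]]] /KP[m' [b' [m'I ->]]].
  apply/KP; exists (c * m + m'), (c * b + b'); split.
    by rewrite rpredD //; apply: (@rpredZ _ _ I c (m : A^o)).
  rewrite [_ *: _]mulrDr !mulrDl mulrA -!addrA; congr (_ + _).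
  by rewrite addrCA.
pose KC := GRing.isSubmodClosed.Build A A^o K Ksub.
pose KS : submodClosed A^o := HB.pack K KC.
have IK : {subset I <= KS}.
  by move=> m mI; apply/KP; exists (m : A), 0; rewrite mul0r addr0.
have yaK : ((y : A) * a : A^o) \in KS.
  by apply/KP; exists 0, 1; rewrite mul1r add0r rpred0.
have /negPn K1 : ~~ ((1 : A^o) \notin KS).
  by apply/negP => K1; case/negP: yaI; apply: maxI IK K1 _ yaK.
have /KP[m [b [mI aE]]] : (a : A^o) \in KS.
  by have := @rpredZ _ _ KS a _ K1; rewrite [_ *: _]mulr1.
have J1 : (1 - b * (y : A) : A^o) \in J.
  apply: IJ; rewrite unfold_in /= mulrBl mul1r -mulrA.
  by rewrite {1}aE addrK.
rewrite -[1 : A^o](subrK (b * (y : A) : A^o)) rpredD //.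
exact: (@rpredZ _ _ J b y).
Qed.

End Transporter.

Lemma jacobson_radicalMr (a x : A) :
  jacobson_radical x -> jacobson_radical (x * a).
Proof.
move=> Jx I mI; case: (boolP ((a : A^o) \in I)) => [aI | aI].
  exact: (@rpredZ _ _ I x (a : A^o)).
exact: Jx (transporter_maximal mI aI).
Qed.

Lemma inner_der_sub : {subset inner_der <= der_rad}.
Proof.
move=> d /inner_derP[a dE]; apply/der_radP; split=> x => [y|Jx].
  by rewrite !dE mulrBl mulrBr !mulrA addrA subrK.
rewrite dE; apply: jacobson_radicalD.
  exact: jacobson_radicalMl.
exact/jacobson_radicalN/jacobson_radicalMr.
Qed.

Fact der_rad_submod : GRing.submod_closed der_rad.
Proof.
split.
  apply/der_radP; split=> [x y|x _]; rewrite !lfunE /=.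
    by rewrite mul0r mulr0 addr0.
  exact: jacobson_radical0.
move=> c d e /der_radP[dM dJ] /der_radP[eM eJ]; apply/der_radP.
split=> [x y|x Jx]; rewrite !add_lfunE !scale_lfunE.
  rewrite dM eM !mulrDl !mulrDr !scalerDr -!scalerAl -!scalerAr.
  by rewrite addrACA.
by apply: jacobson_radicalD; [apply/jacobson_radicalZ/dJ | apply: eJ].
Qed.

HB.instance Definition _ :=
  GRing.isSubmodClosed.Build k 'End(A) der_rad der_rad_submod.

Record derRad : Type := DerRad {
  der_fun :> 'End(A);
  der_funP : der_fun \in der_rad
}.

HB.instance Definition _ := [isSub for der_fun].
HB.instance Definition _ := [Choice of derRad by <:].
HB.instance Definition _ := [SubChoice_isSubLmodule of derRad by <:].

Definition commutator (d e : 'End(A)) : 'End(A) :=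
  ((d \o e) - (e \o d))%VF.

Lemma commutatorE (d e : 'End(A)) x : commutator d e x = d (e x) - e (d x).
Proof. by rewrite add_lfunE opp_lfunE !comp_lfunE. Qed.

Fact commutator_der_rad (d e : derRad) : commutator d e \in der_rad.
Proof.
case: d e => [d /der_radP[dM dJ]] [e /der_radP[eM eJ]] /=.
apply/der_radP; split=> [x y|x Jx]; rewrite !commutatorE.
  rewrite dM eM !linearD /= !dM !eM mulrBl mulrBr.
  have aux (a b c u v w : A) :
    a + b + (c + u) - (v + c + (b + w)) = a - v + (u - w).
    rewrite (addrC c u) (addrACA a) (addrC b w) (addrACA v) (addrC c b).
    by rewrite [- (_ + _ + _)]opprD [LHS]addrACA subrr addr0 opprD addrACA.
  by rewrite -opprD aux.
by apply: jacobson_radicalD; [apply/dJ/eJ | apply/jacobson_radicalN/eJ/dJ].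
Qed.

Definition der_lie (d e : derRad) : derRad := DerRad (commutator_der_rad d e).

Fact der_lie_linearl f : linear (fun d => der_lie d f).
Proof.
move=> c d e; apply/val_inj/lfunP => x.
rewrite /= !(commutatorE, add_lfunE, scale_lfunE) linearP /=.
by rewrite scalerBr opprD addrACA.
Qed.

Fact der_lie_linearr f : linear (der_lie f).
Proof.
move=> c d e; apply/val_inj/lfunP => x.
rewrite /= !(commutatorE, add_lfunE, scale_lfunE) linearP /=.
by rewrite scalerBr opprD addrACA.
Qed.

Fact der_liexx d : der_lie d d = 0.
Proof. by apply/val_inj; rewrite /= /commutator subrr. Qed.

Fact der_lie_jacobi d e f :
  der_lie d (der_lie e f) + der_lie e (der_lie f d) + der_lie f (der_lie d e)
    = 0.
Proof.
apply/val_inj/lfunP => x.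
rewrite /= !(commutatorE, add_lfunE, zero_lfunE) !linearB /= !opprK.
have aux (a b c g h i : A) :
  a - b + (- c + g) + (c - h + (- i + b)) + (i - g + (- a + h)) = 0.
  rewrite (addrC (- c)) (addrC (- i)) (addrC (- a)).
  rewrite (addrACA a) (addrACA c) (addrACA i) -!opprD.
  by rewrite (addrC c b) (addrC i h) (addrC g a) !subrKA subrr.
exact: aux.
Qed.

HB.instance Definition _ := Lmodule_isLie.Build k derRad
  der_lie_linearl der_lie_linearr der_liexx der_lie_jacobi.

(* The inner derivations as a subset of derRad; by inner_der_sub, no inner
   derivation is lost. *)
Definition inn : {pred derRad} := [pred d | der_fun d \in inner_der].

Fact inn_submod : GRing.submod_closed inn.
Proof.
split; first by apply/inner_derP; exists 0 => x; rewrite lfunE /= mul0r mulr0 subrr.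
move=> c d e /inner_derP[a dE] /inner_derP[b eE]; apply/inner_derP.
exists (c *: a + b) => x; rewrite /= add_lfunE scale_lfunE dE eE.
by rewrite mulrDl mulrDr scalerBr scalerAl scalerAr opprD addrACA.
Qed.

Fact inn_lie_stable (d e : derRad) : e \in inn -> [lie d, e] \in inn.
Proof.
case/inner_derP=> a eE; apply/inner_derP; exists (d a) => x.
have /der_radP[dM _] := der_funP d.
rewrite /= commutatorE !eE linearB /= !dM.
have aux (p q r s : A) : p + q - (r + s) - (q - r) = p - s.
  by rewrite opprB (addrC r s) opprD (addrACA p) -[LHS]addrA subrKA subrr addr0.
exact: aux.
Qed.

Definition inn_ideal : lieIdeal derRad := LieIdeal inn_submod inn_lie_stable.

Definition HH1rad : lieAlgType k := lie_quot inn_ideal.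

End Derivations.

Arguments HH1rad {k} A.

Section RepresentationType.
Variables (k : fieldType) (A : falgType k).

(* An A-module is a k-vector space by restriction along k -> A, c |-> c%:A. *)
Definition fin_dim_module (V : lmodType A) : Prop :=
  exists (n : nat) (e : 'I_n -> V),
    forall v : V, exists c : 'I_n -> k, v = \sum_i (c i)%:A *: e i.

Definition indecomposable_module (V : lmodType A) : Prop :=
  (exists v : V, v != 0) /\
  forall U W : submodClosed V,
    (forall v : V, exists u w, [/\ u \in U, w \in W & v = u + w]) ->
    (forall v : V, v \in U -> v \in W -> v = 0) ->
    (forall u : V, u \in U -> u = 0) \/ (forall w : V, w \in W -> w = 0).

Definition isomorphic_modules (V W : lmodType A) : Prop :=
  exists f : {linear V -> W}, bijective f.

(* The M i need not be indecomposable: they only bound the number of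
   isomorphism classes of finite-dimensional indecomposables. *)
Definition finite_representation_type : Prop :=
  exists (n : nat) (M : 'I_n -> lmodType A),
    forall V : lmodType A, fin_dim_module V -> indecomposable_module V ->
      exists i, isomorphic_modules V (M i).

End RepresentationType.

Arguments finite_representation_type {k} A.

(* Main.v *)
Require Import Defs.
From HB Require Import structures.
From mathcomp Require Import all_boot all_algebra all_field.
From mathcomp Require Import boolp.

(** Write [J] for the Jacobson radical of [A].

    Over an algebraically closed field, a decomposition of [1] into orthogonal
    primitive idempotents [e_i] gives a system of elements [a_i b_j], one for
    each pair of equivalent idempotents [e_i], [e_j], that behaves like matrix
    units and spans a complement of [J].  Given a derivation [d] preserving [J],
    the element [c = sum_i d(a_i) b_i] is such that [d - [c, -]] kills these
    matrix units, hence maps [A] into [J] ([derivation_inner_mod_radv]).  So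
    every class of [HH1rad A] is represented by a derivation [d] with
    [d(A) <= J].  Such a [d] induces on the layer [J / J^2] a map preserving
    every Peirce component [e_i (J / J^2) e_j].

    Finite representation type forces each of these components to have dimension
    at most one ([finite_rep_layer_dim]): two independent elements [x], [y] of
    [e (J / J^2) f] give the modules [A / (A(1 - f) + A(x - c y) + J^2)] for [c]
    in [k], which are indecomposable (they have a primitive idempotent generator,
    whose endomorphisms come from the local algebra [fAf]) and pairwise
    nonisomorphic, while [k] is infinite.  Hence two derivations with values in
    [J] commute on [J / J^2]: their commutator raises the radical filtration by
    one ([derivation_layer_commute]).

    Derivations raising the radical filtration by [s > 0] have commutators
    raising it by more ([der_filtered_commutator]); as [J] is nilpotent
    ([radv_nilpotent]), the derived series reaches zero. *)

Set Implicit Arguments.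
Unset Strict Implicit.
Unset Printing Implicit Defensive.

Import GRing.Theory.
Local Open Scope ring_scope.
Local Open Scope quotient_scope.

(** * Subspaces of a finite-dimensional space *)

Section Subspaces.
Variables (k : fieldType) (V : vectType k).

(** Every nonempty family of subspaces has a member of maximal dimension. *)
Lemma ex_max_dim (P : {vspace V} -> Prop) (U : {vspace V}) :
  P U -> exists2 W, P W & forall W', P W' -> (\dim W' <= \dim W)%N.
Proof.
move=> PU.
pose Q := [pred n | `[< exists2 W, P W & \dim W = n >]].
have exQ : exists n, Q n by exists (\dim U); apply/asboolP; exists U.
have ubQ n : Q n -> (n <= \dim {:V})%N.
  by move=> /asboolP[W _ <-]; apply/dimvS/subvf.
case: (ex_maxnP exQ ubQ) => n /asboolP[W PW <-] maxW.
by exists W => // W' PW'; apply: maxW; apply/asboolP; exists W'.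
Qed.

Lemma vspace_of_pred (P : V -> Prop) :
    P 0 -> (forall c u v, P u -> P v -> P (c *: u + v)) ->
  exists U : {vspace V}, forall v, v \in U <-> P v.
Proof.
move=> P0 Plin.
have [|U PU maxU] := @ex_max_dim (fun W => forall v, v \in W -> P v) 0%VS.
  by move=> v; rewrite memv0 => /eqP->.
exists U => v; split=> [/PU //|Pv].
suff /eqP-> : U == (U + <[v]>)%VS by apply: (subvP (addvSr _ _)); apply: memv_line.
rewrite eqEdim addvSl maxU // => w /memv_addP[u uU [z /vlineP[c ->] ->]].
by rewrite addrC; apply: Plin; [apply: Pv | apply: PU].
Qed.

End Subspaces.

(** * The Jacobson radical of a finite-dimensional algebra *)

Section LeftIdeals.
Variables (k : fieldType) (A : falgType k).
Implicit Types (U W : {vspace A}) (a x y : A).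

(** Left ideals, as linear subspaces stable under left multiplication. *)
Definition left_ideal U : Prop := forall a x, x \in U -> a * x \in U.

Lemma left_ideal_add U W : left_ideal U -> left_ideal W -> left_ideal (U + W).
Proof.
move=> lU lW a x /memv_addP[u uU [w wW ->]].
by rewrite mulrDr memv_add ?lU ?lW.
Qed.

(** The principal left ideal [A x]. *)
Definition princ x : {vspace A} := limg (amulr x).

Lemma princP x y : reflect (exists a, y = a * x) (y \in princ x).
Proof.
apply: (iffP memv_imgP) => [[a _ ->]|[a ->]]; exists a; rewrite ?memvf //.
  by rewrite lfunE.
by rewrite lfunE.
Qed.

Lemma left_ideal_princ x : left_ideal (princ x).
Proof. by move=> a y /princP[b ->]; apply/princP; exists (a * b); rewrite mulrA. Qed.

Lemma mem_princ x : x \in princ x.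
Proof. by apply/princP; exists 1; rewrite mul1r. Qed.

(** [left_ideal_submod] and [submod_left_ideal] identify the submodules of the
    left regular module with the subspaces that are left ideals. *)
Lemma left_ideal_submod U : left_ideal U ->
  exists I : submodClosed A^o, forall x, ((x : A^o) \in I) = (x \in U).
Proof.
move=> lU; pose K : {pred A^o} := fun z => (z : A) \in U.
have Ksub : GRing.submod_closed K.
  split=> [|a u v uU vU]; rewrite unfold_in /=; first exact: mem0v.
  by apply: rpredD => //; apply: lU.
pose KC := GRing.isSubmodClosed.Build A A^o K Ksub.
by exists (HB.pack K KC : submodClosed A^o).
Qed.

Lemma submod_left_ideal (I : submodClosed A^o) :
  exists2 U, left_ideal U & forall x, (x \in U) = ((x : A^o) \in I).
Proof.
have [||U UE] := @vspace_of_pred _ A (fun x => is_true ((x : A^o) \in I)).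
- exact: rpred0.
- move=> c u v uI vI; apply: rpredD => //.
  by have := @rpredZ _ _ I (c%:A) _ uI; rewrite /GRing.scale /= -scalerAl mul1r.
have UE' x : (x \in U) = ((x : A^o) \in I) by apply/idP/idP => /UE.
by exists U => // a x; rewrite !UE' => xI; apply: (@rpredZ _ _ I a (x : A^o)).
Qed.

Lemma jacobson_radical_lin (c : k) x y :
  jacobson_radical x -> jacobson_radical y -> jacobson_radical (c *: x + y).
Proof. by move=> Jx Jy; apply: jacobson_radicalD => //; apply: jacobson_radicalZ. Qed.

(** The Jacobson radical as a linear subspace. *)
Definition radv : {vspace A} :=
  sval (cid (vspace_of_pred (@jacobson_radical0 _ A) jacobson_radical_lin)).

Lemma radvP x : x \in radv <-> jacobson_radical x.
Proof. exact: (svalP (cid (vspace_of_pred (@jacobson_radical0 _ A) _)) x). Qed.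

Lemma radvMl a x : x \in radv -> a * x \in radv.
Proof. by move=> /radvP xJ; apply/radvP/jacobson_radicalMl. Qed.

Lemma radvMr a x : x \in radv -> x * a \in radv.
Proof. by move=> /radvP xJ; apply/radvP/jacobson_radicalMr. Qed.

(** If [A (1 - x)] were proper, it would lie in a maximal left ideal, and this
    ideal also contains [x]. *)
Lemma radv_quasireg x : x \in radv -> exists u, u * (1 - x) = 1.
Proof.
move=> xJ; case: (boolP (1 \in princ (1 - x))) => [/princP[u E]|n1].
  by exists u.
have [|W [lW PW nW] maxW] := @ex_max_dim _ A
  (fun W => [/\ left_ideal W, (princ (1 - x) <= W)%VS & 1 \notin W])
  (princ (1 - x)).
  by split=> //; apply: left_ideal_princ.
have [I IE] := left_ideal_submod lW.
suff mI : maximal_left_ideal I.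
  case/negP: nW; rewrite -(subrK x 1) rpredD //.
    exact: (subvP PW _ (mem_princ _)).
  by rewrite -IE; move/radvP: xJ; apply.
split=> [|J IJ J1]; first by rewrite IE.
have [W' lW' W'E] := submod_left_ideal J.
have WW' : (W <= W')%VS.
  by apply/subvP => y yW; rewrite W'E; apply: IJ; rewrite IE.
have /eqP EW : W == W'.
  rewrite eqEdim WW' maxW //; split=> //; first exact: subv_trans WW'.
  by rewrite W'E.
by move=> y; rewrite -W'E -EW -IE.
Qed.

(** If [A x] is nil, then [x] lies in every maximal left ideal. *)
Lemma nil_radv x : (forall y, exists n, (y * x) ^+ n = 0) -> x \in radv.
Proof.
move=> nilx; apply/radvP => I [I1 maxI]; apply: contraT => xI.
have [U lU UE] := submod_left_ideal I.
have lW : left_ideal (U + princ x).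
  by apply: left_ideal_add => //; apply: left_ideal_princ.
have [K KE] := left_ideal_submod lW.
have IK : {subset I <= K}.
  by move=> y; rewrite KE -UE; apply/subvP/addvSl.
have : (1 : A^o) \in K.
  apply: contraT => K1; case/negP: xI; apply: (maxI K IK K1).
  by rewrite KE; apply: (subvP (addvSr _ _)); apply: mem_princ.
rewrite KE => /memv_addP[m mU [_ /princP[y ->] E1]].
have [n yxn] := nilx y.
case/negP: I1; rewrite -UE.
(* [m = 1 - y x] lies in [I] and is left invertible: geometric series. *)
have -> : 1 = (\sum_(i < n) (y * x) ^+ i) * m.
  have -> : m = 1 - y * x by rewrite E1 addrK.
  have := subrX1 (y * x) n; rewrite yxn sub0r => E.
  have C : GRing.comm (y * x - 1) (\sum_(i < n) (y * x) ^+ i).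
    apply: commr_sum => i _; apply/commr_sym/commrB; last exact: commr1.
    exact/commr_sym/commrX.
  by rewrite -opprB mulrN -C -E opprK.
exact: lU.
Qed.

Lemma radv_idem e : e \in radv -> e * e = e -> e = 0.
Proof.
move=> eJ ee; have [u ue] := radv_quasireg eJ.
by rewrite -[e]mul1r -ue -mulrA mulrBl mul1r ee subrr mulr0.
Qed.

(** Nakayama's lemma, applied to [U] modulo a maximal proper left ideal [W] of
    [U]: the radical kills the simple quotient [U / W]. *)
Lemma radv_nakayama U : left_ideal U -> (U <= radv * U)%VS -> U = 0%VS.
Proof.
move=> lU UJU; apply/eqP; apply: contraT => nzU.
have [|W [lW WU nW] maxW] := @ex_max_dim _ A
    (fun W => [/\ left_ideal W, (W <= U)%VS & W != U]) 0%VS.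
  split; [|exact: sub0v|by rewrite eq_sym].
  by move=> a x; rewrite memv0 => /eqP->; rewrite mulr0 mem0v.
have maxW' W' : left_ideal W' -> (W <= W')%VS -> (W' <= U)%VS -> W' != W -> W' = U.
  move=> lW' WW' W'U nWW'; apply/eqP; apply: contraNT nWW' => nW'U.
  by rewrite eq_sym eqEdim WW' maxW.
have : ~~ (U <= W)%VS by apply: contra nW => UW; rewrite eqEsubv WU.
case/subvPn=> x xU xW.
have J_x j : j \in radv -> j * x \in W.
  move=> jJ; apply: contraT => jxW.
  have EU : (W + (radv * <[x]>))%VS = U.
    apply: maxW'.
    - apply: left_ideal_add => // a y; rewrite -limg_amulr => /memv_imgP[b bJ ->].
      rewrite lfunE /= mulrA; apply/memv_imgP; exists (a * b).
        exact: radvMl.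
      by rewrite lfunE.
    - exact: addvSl.
    - apply/subvP => y /memv_addP[w wW [z]]; rewrite -limg_amulr.
      move=> /memv_imgP[b bJ ->] ->; rewrite lfunE /= rpredD //.
        exact: (subvP WU).
      exact: lU.
    apply: contra jxW => /eqP E; rewrite -E; apply: (subvP (addvSr W _)).
    by apply: memv_mul => //; apply: memv_line.
  move: (xU); rewrite -EU => /memv_addP[w wW [z]]; rewrite -limg_amulr.
  move=> /memv_imgP[b bJ ->]; rewrite lfunE /= => Ex.
  have [u ub] := radv_quasireg bJ.
  case/negP: xW; rewrite -[x]mul1r -ub -mulrA; apply: lW.
  by rewrite mulrBl mul1r {1}Ex addrK.
have EU : (W + princ x)%VS = U.
  apply: maxW'.
  - by apply: left_ideal_add => //; apply: left_ideal_princ.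
  - exact: addvSl.
  - apply/subvP => y /memv_addP[w wW [_ /princP[a ->] ->]].
    by apply: rpredD; [apply: (subvP WU) | apply: lU].
  apply: contra xW => /eqP E; rewrite -E; apply: (subvP (addvSr W _)); exact: mem_princ.
case/negP: xW; apply: (subvP _ _ xU); apply: subv_trans UJU _.
apply/prodvP => j y jJ; rewrite -EU => /memv_addP[w wW [_ /princP[a ->] ->]].
by rewrite mulrDr; apply: rpredD; [apply: lW | rewrite mulrA J_x ?radvMr].
Qed.

Lemma radvX_Ml m a x : x \in (radv ^+ m.+1)%VS -> a * x \in (radv ^+ m.+1)%VS.
Proof.
move=> xJ; suff /subvP s : (radv ^+ m.+1 <= amull a @^-1: (radv ^+ m.+1))%VS.
  by have := s _ xJ; rewrite -memv_preim lfunE.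
rewrite {1}expvSl; apply/prodvP => j y jJ yJ; rewrite -memv_preim lfunE /= mulrA.
by rewrite expvSl memv_mul // radvMl.
Qed.

Lemma radvX_Mr m a x : x \in (radv ^+ m.+1)%VS -> x * a \in (radv ^+ m.+1)%VS.
Proof.
move=> xJ; suff /subvP s : (radv ^+ m.+1 <= amulr a @^-1: (radv ^+ m.+1))%VS.
  by have := s _ xJ; rewrite -memv_preim lfunE.
rewrite {1}expvSr; apply/prodvP => y j yJ jJ; rewrite -memv_preim lfunE /= -mulrA.
by rewrite expvSr memv_mul // radvMr.
Qed.

Lemma radvX_decr m : (radv ^+ m.+2 <= radv ^+ m.+1)%VS.
Proof. by rewrite expvSl; apply/prodvP => j y jJ yJ; apply: radvX_Ml. Qed.

Lemma radvX_sub m n : (n <= m)%N -> (radv ^+ m.+1 <= radv ^+ n.+1)%VS.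
Proof.
elim: m => [|m IHm]; first by rewrite leqn0 => /eqP->.
rewrite leq_eqVlt => /predU1P[-> //|/IHm]; apply: subv_trans; exact: radvX_decr.
Qed.

Lemma radv_nilpotent : exists m, (radv ^+ m.+1 = 0)%VS.
Proof.
have bd m : (radv ^+ m.+1 = 0)%VS \/ (\dim (radv ^+ m.+1)%VS + m <= \dim {:A})%N.
  elim: m => [|m [IH|IH]].
  - by right; rewrite addn0 dimvS ?subvf.
  - by left; rewrite expvSl IH prodv0.
  have [E|NE] := eqVneq (radv ^+ m.+2)%VS (radv ^+ m.+1)%VS.
    by left; rewrite E; apply: radv_nakayama => [a x|]; [exact: radvX_Ml | rewrite -expvSl E].
  right; apply: leq_trans IH; rewrite addnS -addSn leq_add2r.
  rewrite ltn_neqAle dimvS ?radvX_decr // andbT; apply: contra NE => /eqP E.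
  by rewrite eqEdim radvX_decr E leqnn.
exists (\dim {:A}).+1; case: (bd (\dim {:A}).+1) => //.
by rewrite addnS ltnNge leq_addl.
Qed.

End LeftIdeals.

(** * Primitive idempotents *)

Section Idempotents.
Variables (k : fieldType) (A : falgType k).
Implicit Types (e f g h x y z : A).

(** [e] is nonzero and the only idempotents of [eAe] are [0] and [e]. *)
Definition primitive_idem e : Prop :=
  [/\ e != 0, e * e = e
    & forall g, g * g = g -> e * g = g -> g * e = g -> g = 0 \/ g = e].

Lemma primitive_notin_radv e : primitive_idem e -> e \notin radv A.
Proof.
by case=> nz ee _; apply: contra nz => eJ; apply/eqP/radv_idem.
Qed.

(** By induction on the dimension of the right ideal [gA]. *)
Lemma primitive_decomposition g : g * g = g ->
  exists (T : finType) (e : T -> A), [/\ forall i, primitive_idem (e i),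
    forall i j, i != j -> e i * e j = 0 & \sum_i e i = g].
Proof.
have [n] := ubnP (\dim (limg (amull g))); elim: n g => // n IHn g le_g gg.
have [->|nzg] := eqVneq g 0.
  by exists void, (fun _ => 0); split=> [[]|[]|]; rewrite big1 // => -[].
have [gP|] := pselect (forall h, h * h = h -> g * h = h -> h * g = h -> h = 0 \/ h = g).
  exists unit, (fun _ => g); split=> [_|[] [] //|]; first by split.
  by rewrite (big_pred1 tt) // => -[].
rewrite -existsNE => -[h]; rewrite !not_implyE not_orE.
case=> hh [gh [hg [nzh nhg]]].
have small a : a * a = a -> g * a = a -> a * g = a -> a <> g ->
  (\dim (limg (amull a)) < n)%N.
  move=> aa ga ag nag; move: le_g; rewrite ltnS; apply: leq_trans.
  have sub : (limg (amull a) <= limg (amull g))%VS.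
    apply/subvP => _ /memv_imgP[x _ ->]; apply/memv_imgP.
    by exists (a * x); rewrite ?memvf // !lfunE /= mulrA ga.
  rewrite ltn_neqAle dimvS // andbT; apply/negP => /eqP E; case: nag.
  have : g \in limg (amull a).
    have /eqP-> : limg (amull a) == limg (amull g) by rewrite eqEdim sub E leqnn.
    by apply/memv_imgP; exists 1; rewrite ?memvf // lfunE /= mulr1.
  by case/memv_imgP => x _; rewrite lfunE /= => Eg; rewrite -ag Eg mulrA aa.
have Dh : (g - h) * (g - h) = g - h.
  by rewrite mulrBl !mulrBr gg gh hg hh subrr subr0.
have [T1 [e1 [p1 o1 s1]]] := IHn h (small h hh gh hg nhg) hh.
have [T2 [e2 [p2 o2 s2]]] : exists (T : finType) (e : T -> A),
  [/\ forall i, primitive_idem (e i),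
      forall i j, i != j -> e i * e j = 0 & \sum_i e i = g - h].
  apply: (IHn _ _ Dh); apply: small => //.
  - by rewrite mulrBr gg gh.
  - by rewrite mulrBl gg hg.
  - by move=> /eqP; rewrite -subr_eq0 addrAC subrr add0r oppr_eq0 => /eqP.
have absl (T : finType) (e : T -> A) a i : (forall i, primitive_idem (e i)) ->
    (forall i j, i != j -> e i * e j = 0) -> \sum_i e i = a -> a * e i = e i.
  move=> p o <-; rewrite mulr_suml (bigD1 i) //= big1 ?addr0; last first.
    by move=> j ji; apply: o.
  by case: (p i).
have absr (T : finType) (e : T -> A) a i : (forall i, primitive_idem (e i)) ->
    (forall i j, i != j -> e i * e j = 0) -> \sum_i e i = a -> e i * a = e i.
  move=> p o <-; rewrite mulr_sumr (bigD1 i) //= big1 ?addr0; last first.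
    by move=> j ji; apply: o; rewrite eq_sym.
  by case: (p i).
exists (T1 + T2)%type, (fun i => match i with inl i => e1 i | inr i => e2 i end).
split=> [[]//|[i|i] [j|j] nij|]; rewrite /=.
- by apply: o1.
- rewrite -(absr _ _ _ i p1 o1 s1) -(absl _ _ _ j p2 o2 s2) mulrA -(mulrA _ h).
  by rewrite mulrBr hg hh subrr mulr0 mul0r.
- rewrite -(absr _ _ _ i p2 o2 s2) -(absl _ _ _ j p1 o1 s1) mulrA -(mulrA _ (g - h)).
  by rewrite mulrBl gh hh subrr mulr0 mul0r.
- by apply: o2.
by rewrite big_sumType /= s1 s2 addrC subrK.
Qed.

(** The evaluation at [x] of the polynomials of degree at most [\dim A] is not
    injective. *)
Lemma annihilating_poly x : exists2 p : {poly k}, p != 0 & horner_alg x p = 0.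
Proof.
pose n := (\dim {:A}).+1.
have phi_lin : linear (fun r : 'rV[k]_n => horner_alg x (rVpoly r)).
  by move=> c u v; rewrite 2!linearP /= mulr_algl.
pose HC := GRing.isLinear.Build _ _ _ _ _ phi_lin.
pose phi : {linear 'rV[k]_n -> A} :=
  HB.pack (fun r : 'rV[k]_n => horner_alg x (rVpoly r)) HC.
have /subvPn[r] : ~~ (lker (linfun phi) <= 0)%VS.
  rewrite subv0 -dimv_eq0; apply/eqP => E.
  have := limg_ker_dim (linfun phi) fullv.
  rewrite capfv E add0n dimvf /dim /= mul1n => D.
  by have := dimvS (subvf (limg (linfun phi))); rewrite D ltnn.
rewrite memv_ker lfunE memv0 /= => /eqP hr nzr.
exists (rVpoly r) => //; apply: contra nzr => /eqP E.
by rewrite -(rVpolyK r) E linear0.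
Qed.

End Idempotents.

Section PrimitiveIdempotents.
Variables (k : closedFieldType) (A : falgType k).
Implicit Types (e f g h x y z : A).

Lemma horner_alg_comm e x (p : {poly k}) :
  GRing.comm e x -> GRing.comm e (horner_alg x p).
Proof.
move=> ex; elim/poly_ind: p => [|p c IHp]; first by rewrite rmorph0; apply: commr0.
rewrite rmorphD rmorphM /= horner_algX horner_algC.
apply: commrD; first exact: commrM.
by rewrite /GRing.comm mulr_algl mulr_algr.
Qed.

(** Over an algebraically closed field, every element of [eAe], for [e] a
    primitive idempotent, has a single eigenvalue [c]. *)
Lemma primitive_nilpotent_shift e x : primitive_idem e -> e * x = x -> x * e = x ->
  exists c n, (x - c *: e) ^+ n = 0.
Proof.
move=> [nze ee prime_] ex xe.
have cex : GRing.comm e x by rewrite /GRing.comm ex xe.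
pose H := horner_alg x.
have H1 : H 1 = 1 by apply: rmorph1.
have HM a b : H (a * b) = H a * H b by apply: rmorphM.
have HD a b : H (a + b) = H a + H b by apply: rmorphD.
have comm_e p : e * H p = H p * e by apply: horner_alg_comm.
suff [c [n En]] : exists c n, e * H (('X - c%:P) ^+ n) = 0.
  have Hc : H ('X - c%:P) = x - c%:A.
    by rewrite /H rmorphB /= horner_algX horner_algC.
  exists c, n.+1.
  have -> : (x - c *: e) ^+ n.+1 = e * H (('X - c%:P) ^+ n) * (x - c *: e).
    elim: (n) => [|i IHi].
      by rewrite expr1 expr0 H1 mulr1 mulrBr ex -scalerAr ee.
    rewrite exprSr IHi exprSr HM Hc mulrA -!mulrA; congr (_ * (_ * _)).
    by rewrite !(mulrBl, mulr_algl); congr (_ - _); rewrite -scalerAl mulrBr ex -scalerAr ee.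
  by rewrite En mul0r.
(* Induction on the size of a polynomial [p] annihilating [x] in [eAe].  At a
   root [c] of [p], write [p = q ('X - c) ^+ n] with coprime factors; the
   corresponding idempotent [g] of [eAe] is [0] or [e], and accordingly [q] or
   [('X - c) ^+ n] annihilates [x]. *)
have [p nzp hp] := annihilating_poly x.
have {hp} : e * H p = 0 by rewrite /H hp mulr0.
have [m] := ubnP (size p); elim: m p nzp => // m IHm p nzp le_p ep.
have [/eqP/size_poly1P[c nzc Ep]|] := eqVneq (size p) 1%N.
  move: ep; rewrite Ep /H horner_algC mulr_algr => /eqP.
  by rewrite scaler_eq0 (negPf nzc) (negPf nze).
move=> /closed_rootP[c rc].
have [n [q]] := multiplicity_XsubC p c; rewrite nzp /= => nrq Ep.
have /Bezout_eq1_coprimepP[[u v] /= uv] : coprimep (('X - c%:P) ^+ n) q.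
  by rewrite coprimep_expl // coprimep_sym coprimep_XsubC.
have HC a b : H a * H b = H b * H a by rewrite -!HM mulrC.
pose g := e * H (v * q).
have gX : g * H (('X - c%:P) ^+ n) = 0.
  by rewrite /g -mulrA -HM -mulrA -Ep mulrC HM mulrA ep mul0r.
have g_e : g = e - e * H (u * ('X - c%:P) ^+ n).
  by rewrite /g -[X in X - _]mulr1 -H1 -uv HD mulrDr addrC addKr.
have eg : e * g = g by rewrite /g mulrA ee.
have ge : g * e = g by rewrite /g -mulrA -comm_e mulrA ee.
have gg : g * g = g.
  rewrite {2}g_e mulrBr ge mulrA ge (mulrC u) HM mulrA gX mul0r subr0 //.
case: (prime_ g gg eg ge) => g0; last first.
  by exists c, n; rewrite -g0.
apply: (IHm q).
- by apply: contraNneq nrq => ->; apply: root0.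
- rewrite -ltnS; apply: leq_trans le_p; rewrite ltnS Ep.
  rewrite size_Mmonic ?monicXn; last 2 first.
  + by apply: contraNneq nrq => ->; apply: root0.
  + by rewrite monic_exp ?monicXsubC.
  rewrite size_exp_XsubC addnS /=.
  case: n Ep {uv gX g_e} => [|n] Ep; last by rewrite addnS ltnS leq_addr.
  by move: rc; rewrite Ep expr0 mulr1 (negPf nrq).
- have Eq : q = p * u + (v * q) * q.
    by rewrite -[LHS]mul1r -uv mulrDl; congr (_ + _); rewrite -mulrA -(mulrC q) -Ep mulrC.
  by rewrite {1}Eq HD !HM mulrDr mulrA ep mul0r add0r -HM mulrA -/g g0 mul0r.
Qed.

(** An element of [eAf] outside the radical is an isomorphism between [e] and
    [f]: some [y x], with [y] in [fAe], is not nilpotent, hence invertible in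
    [fAf], since its only eigenvalue [c] is nonzero. *)
Lemma primitive_radv_or_inverse e f x : primitive_idem e -> primitive_idem f ->
    e * x = x -> x * f = x ->
  x \in radv A \/ exists y, [/\ f * y = y, y * e = y, y * x = f & x * y = e].
Proof.
move=> pe pf ex xf; have [nze ee ie] := pe; have [nzf ff if_] := pf.
have [nil|] := pselect (forall y, f * y = y -> y * e = y -> exists n, (y * x) ^+ n = 0).
  left; apply: nil_radv => y.
  have [||n yn] := nil (f * y * e); rewrite ?mulrA ?ff -?mulrA ?ee //.
  exists n.+1.
  have -> : (y * x) ^+ n.+1 = (y * x) * (f * y * e * x) ^+ n.
    elim: n {yn} => [|n IHn]; first by rewrite expr1 expr0 mulr1.
    rewrite exprS IHn exprS; set W := _ ^+ n.
    by rewrite !mulrA -(mulrA y x f) xf -(mulrA _ e x) ex.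
  by rewrite yn mulr0.
rewrite -existsNE => -[y]; rewrite !not_implyE => -[fy [ye nny]]; right.
have [||c [n En]] := @primitive_nilpotent_shift f (y * x) pf.
- by rewrite mulrA fy.
- by rewrite -mulrA xf.
set z := _ - _ in En.
have nzc : c != 0.
  by apply: contra_not_neq nny => c0; exists n; move: En; rewrite /z c0 scale0r subr0.
have fz : f * z = z by rewrite /z mulrBr mulrA fy -scalerAr ff.
have zf : z * f = z by rewrite /z mulrBl -mulrA xf -scalerAl ff.
pose w := \sum_(i < n) (- (c^-1 *: z)) ^+ i.
have wz : w * (1 + c^-1 *: z) = 1.
  have E := subrX1 (- (c^-1 *: z)) n.
  have Ez : (- (c^-1 *: z)) ^+ n = 0.
    by rewrite exprNn exprZn En scaler0 mulr0.
  have C : GRing.comm (1 + c^-1 *: z) w.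
    apply: commr_sum => i _; apply: commrX; apply: commrN.
    by rewrite /GRing.comm mulrDl mulrDr mul1r mulr1.
  rewrite -C; apply: oppr_inj; rewrite -mulNr opprD addrC -E Ez sub0r //.
have yxE : y * x = c *: (f * (1 + c^-1 *: z)).
  by rewrite mulrDr mulr1 -scalerAr fz scalerDr scalerA divff // scale1r /z addrC subrK.
pose y' := c^-1 *: (f * w * y).
have yx : y' * x = f.
  rewrite /y' -scalerAl -(mulrA _ y x) yxE -scalerAr scalerA mulVf // scale1r.
  have -> : f * (1 + c^-1 *: z) = (1 + c^-1 *: z) * f.
    by rewrite mulrDr mulrDl mulr1 mul1r -scalerAl -scalerAr fz zf.
  by rewrite mulrA -(mulrA f w) wz mulr1 ff.
have fy' : f * y' = y' by rewrite /y' -scalerAr !mulrA ff.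
have ye' : y' * e = y' by rewrite /y' -scalerAl -(mulrA _ y e) ye.
exists y'; split=> //.
have [||||//] := ie (x * y').
- by rewrite mulrA -(mulrA x) yx xf.
- by rewrite mulrA ex.
- by rewrite -mulrA ye'.
move=> xy0; case/eqP: nzf; rewrite -ff -[in LHS]yx -mulrA.
by rewrite (mulrA x) xy0 mul0r mulr0.
Qed.

(** For [e] primitive, [eAe] is local with residue field [k]. *)
Lemma primitive_residue e x : primitive_idem e -> e * x = x -> x * e = x ->
  exists c, x - c *: e \in radv A.
Proof.
move=> pe ex xe; have [nze ee _] := pe.
have [c [n En]] := primitive_nilpotent_shift pe ex xe.
exists c; set z := _ - _ in En *.
have ez : e * z = z by rewrite /z mulrBr -scalerAr ex ee.
have ze : z * e = z by rewrite /z mulrBl -scalerAl xe ee.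
case: (primitive_radv_or_inverse pe pe ez ze) => // -[y [ey ye yz zy]].
case/eqP: nze; rewrite -(mul0r e) -[in RHS](mulr0 (y ^+ n)) -En.
elim: n {En} => [|n IHn]; first by rewrite !expr0 !mul1r.
rewrite exprS exprSr -!mulrA ze -{2}ez (mulrA _ e) (mulrA (y ^+ n)) (mulrA (y ^+ n)).
by rewrite -IHn mulrA ye yz.
Qed.

End PrimitiveIdempotents.

(** * Derivations preserving the radical, up to inner derivations *)

(** The Leibniz rule; linearity is part of the type of [d]. *)
Definition derivation (k : fieldType) (A : falgType k) (d : 'End(A)) : Prop :=
  forall x y, d (x * y) = d x * y + x * d y.

Section IdempotentEquivalence.
Variables (k : fieldType) (A : falgType k).
Implicit Types (e f g : A).

(** Equivalence of idempotents: the left modules [Ae] and [Af] are isomorphic,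
    through right multiplication by [a] and [b]. *)
Definition idem_equiv e f : Prop := exists a b : A,
  [/\ e * a = a, a * f = a, f * b = b, b * e = b & a * b = e /\ b * a = f].

Lemma idem_equiv_refl e : e * e = e -> idem_equiv e e.
Proof. by move=> ee; exists e, e. Qed.

Lemma idem_equiv_sym e f : idem_equiv e f -> idem_equiv f e.
Proof. by case=> a [b [ea af fb be [ab ba]]]; exists b, a. Qed.

Lemma idem_equiv_trans f e g : idem_equiv e f -> idem_equiv f g -> idem_equiv e g.
Proof.
case=> a [b [ea af fb be [ab ba]]] [a' [b' [fa ag gb bf [ab' ba']]]].
exists (a * a'), (b' * b); split.
- by rewrite mulrA ea.
- by rewrite -mulrA ag.
- by rewrite mulrA gb.
- by rewrite -mulrA be.
split; first by rewrite mulrA -(mulrA a) ab' af ab.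
by rewrite mulrA -(mulrA b') ba bf ba'.
Qed.

(** A choice of representatives of the equivalence classes in a family. *)
Lemma idem_equiv_repr (T : finType) (e : T -> A) : (forall i, e i * e i = e i) ->
  exists r : T -> T, (forall i, idem_equiv (e i) (e (r i))) /\
    (forall i j, idem_equiv (e i) (e j) -> r i = r j).
Proof.
move=> ee; exists (fun i => odflt i [pick j | `[< idem_equiv (e i) (e j) >]]).
split=> [i|i j ij].
  by case: pickP => [j /asboolP //|_] /=; apply: idem_equiv_refl.
rewrite (@eq_pick _ (fun l => `[< idem_equiv (e i) (e l) >])
                    (fun l => `[< idem_equiv (e j) (e l) >])).
  case: pickP => //= /(_ j) /negP[]; apply/asboolP; exact: idem_equiv_refl.
move=> l; apply/asboolP/asboolP; apply: idem_equiv_trans => //.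
exact: idem_equiv_sym.
Qed.

End IdempotentEquivalence.

Lemma derivation_idem (k : fieldType) (A : falgType k) (d : 'End(A)) (e : A) :
  derivation d -> e * e = e -> e * d e * e = 0.
Proof.
move=> dM ee; have := congr1 (fun z => e * z * e) (dM e e).
rewrite ee mulrDr mulrDl mulrA -(mulrA (e * d e)) ee mulrA ee.
by move=> /eqP; rewrite -subr_eq0 opprD addrA subrr sub0r oppr_eq0 => /eqP.
Qed.

Lemma derivation_sub_inner (k : fieldType) (A : falgType k) (d : 'End(A)) (a : A) :
  derivation d -> derivation (d - (amull a - amulr a)).
Proof.
move=> dM x y; rewrite !(add_lfunE, opp_lfunE, lfunE) /= dM.
rewrite (mulrBl y) mulrBr (mulrBl y) mulrBr !mulrA addrACA -opprD addrA subrK //.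
Qed.

Section InnerCorrection.
Variables (k : closedFieldType) (A : falgType k) (d : 'End(A)).
Hypotheses (dM : derivation d) (dJ : forall x, x \in radv A -> d x \in radv A).

(** The elements [a i * b j], for [e i] and [e j] equivalent, multiply like matrix
    units and span a complement of the radical; [c] is obtained by applying [d]
    to the left factors of the separability element [sum_i a_i (x) b_i]. *)
Lemma derivation_inner_mod_radv :
  exists a : A, forall x, (d - (amull a - amulr a)) x \in radv A.
Proof.
have [T [e [prim orth sum1]]] := @primitive_decomposition k A 1 (mulr1 1).
have ee i : e i * e i = e i by case: (prim i).
have [r [er rP]] := idem_equiv_repr ee.
have [ab abP] := fin_all_exists (fun i => let: ex_intro a (ex_intro b H) := er i
  in ex_intro (fun u : A * A => [/\ e i * u.1 = u.1, u.1 * e (r i) = u.1,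
       e (r i) * u.2 = u.2, u.2 * e i = u.2 & u.1 * u.2 = e i /\ u.2 * u.1 = e (r i)])
     (a, b) H).
pose a i := (ab i).1; pose b i := (ab i).2.
have ea i : e i * a i = a i by case: (abP i).
have ar i : a i * e (r i) = a i by case: (abP i).
have rb i : e (r i) * b i = b i by case: (abP i).
have be i : b i * e i = b i by case: (abP i).
have abE i : a i * b i = e i by case: (abP i) => _ _ _ _ [].
have baE i : b i * a i = e (r i) by case: (abP i) => _ _ _ _ [].
have ba0 i j : i != j -> b i * a j = 0.
  by move=> ij; rewrite -be -ea mulrA -(mulrA (b i)) orth // mulr0 mul0r.
pose c := \sum_i d (a i) * b i.
exists c; set D := d - _.
have DE x : D x = d x - (c * x - x * c).
  by rewrite !(add_lfunE, opp_lfunE, lfunE).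
have DM : derivation D by apply: derivation_sub_inner.
have DJ x : x \in radv A -> D x \in radv A.
  by move=> xJ; rewrite DE; do 2?apply: rpredB; [apply: dJ | apply: radvMl | apply: radvMr].
have D0 i j : r i = r j -> D (a i * b j) = 0.
  move=> rij.
  have -> : D (a i * b j) = d (a i * b j) - (c * (a i * b j) - (a i * b j) * c).
    exact: DE.
  have -> : c * (a i * b j) = d (a i) * b j.
    rewrite /c mulr_suml (bigD1 i) //= big1 ?addr0 => [|l li].
      by rewrite mulrA -(mulrA (d (a i))) baE -mulrA rij rb.
    by rewrite mulrA -(mulrA (d (a l))) ba0 // mulr0 mul0r.
  have -> : a i * b j * c = - (a i * d (b j)).
    have -> : a i * b j * c = \sum_l a i * (d (b j * a l) - d (b j) * a l) * b l.
      rewrite /c mulr_sumr; apply: eq_bigr => l _.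
      by rewrite dM addrAC subrr add0r !mulrA.
    transitivity (\sum_l (a i * d (b j * a l) * b l) - \sum_l a i * d (b j) * (a l * b l)).
      rewrite -sumrB; apply: eq_bigr => l _.
      by rewrite mulrBr mulrBl !mulrA.
    have sumab : \sum_l a l * b l = 1.
      by rewrite -[RHS]sum1; apply: eq_bigr => l _; apply: abE.
    rewrite -mulr_sumr sumab mulr1 (bigD1 j) //= big1 ?addr0 => [|l lj]; last first.
      by rewrite ba0 1?eq_sym // linear0 mulr0 mul0r.
    rewrite baE -{1}ar rij -{1}rb -!mulrA (mulrA (d _)) (mulrA (e (r j))).
    rewrite (mulrA (e (r j)) (d _)) derivation_idem //.
    by rewrite mul0r mulr0 sub0r.
  by rewrite dM opprK subrr.
move=> x; have -> : x = \sum_i \sum_j e i * x * e j.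
  under eq_bigr do rewrite -mulr_sumr sum1 mulr1.
  by rewrite -mulr_suml sum1 mul1r.
rewrite linear_sum; apply: rpred_sum => i _.
rewrite linear_sum; apply: rpred_sum => j _.
have ey : e i * (e i * x * e j) = e i * x * e j by rewrite !mulrA ee.
have ye : (e i * x * e j) * e j = e i * x * e j by rewrite -!mulrA ee.
move: (e i * x * e j) ey ye => y ey ye.
(* Modulo the radical, [y] vanishes if [e i] and [e j] are not equivalent, and
   is a multiple of the matrix unit [a i * b j] otherwise. *)
have [rij|nrij] := eqVneq (r i) (r j); last first.
  case: (primitive_radv_or_inverse (prim i) (prim j) ey ye) => [/DJ//|[z [h1 h2 h3 h4]]].
  by case/eqP: nrij; apply: rP; exists y, z.
have [||l lP] := @primitive_residue _ _ (e (r i)) (b i * y * a j) (prim _).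
- by rewrite !mulrA rb.
- by rewrite rij -!mulrA ar.
have -> : y = l *: (a i * b j) + a i * (b i * y * a j - l *: e (r i)) * b j.
  rewrite mulrBr mulrBl !mulrA abE -(mulrA _ (a j)) abE  ey ye.
  by rewrite -scalerAr ar -scalerAl addrC subrK.
by rewrite linearD linearZ /= D0 // scaler0 add0r; apply/DJ/radvMr/radvMl.
Qed.

End InnerCorrection.

(** * Quotient modules *)

Section QuotientModule.
Variables (R : nzRingType) (V : lmodType R) (I : submodClosed V).

(** The membership predicate of [I], which carries the closure instances that
    the quotient construction requires. *)
Definition lmod_quot_pred : {pred V} := fun v => v \in I.

Fact lmod_quot_submod : GRing.submod_closed lmod_quot_pred.
Proof.
split=> [|a u v uK vK]; rewrite unfold_in /= ?rpred0 //.
by apply: rpredD => //; apply: rpredZ.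
Qed.

HB.instance Definition _ := GRing.isSubmodClosed.Build R V lmod_quot_pred lmod_quot_submod.

(** The quotient of the left module [V] by the submodule [I]. *)
Definition lmod_quot : Type := {ideal_quot lmod_quot_pred}.

HB.instance Definition _ := GRing.Zmodule.on lmod_quot.
HB.instance Definition _ := EqQuotient.on lmod_quot.

Lemma lmod_quotW (P : lmod_quot -> Prop) :
  (forall x : V, P (\pi_lmod_quot x)) -> forall u, P u.
Proof. exact: quotW. Qed.

Lemma lmod_quot_eqP (x y : V) :
  reflect (\pi_lmod_quot x = \pi_lmod_quot y) (x - y \in I).
Proof. by rewrite -[_ \in I]/(x - y \in lmod_quot_pred) Quotient.idealrBE; apply: eqP. Qed.

Lemma lmod_quot_piD (x y : V) :
  \pi_lmod_quot (x + y) = \pi_lmod_quot x + \pi_lmod_quot y.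
Proof. exact: (Quotient.pi_add lmod_quot_pred). Qed.

Definition lmod_quot_scale (a : R) (u : lmod_quot) : lmod_quot :=
  \pi_lmod_quot (a *: repr u).

Lemma lmod_quot_scaleE a x :
  lmod_quot_scale a (\pi_lmod_quot x) = \pi_lmod_quot (a *: x).
Proof.
apply/lmod_quot_eqP; rewrite -scalerBr rpredZ //.
by apply/lmod_quot_eqP; rewrite reprK.
Qed.

Fact lmod_quot_scalerA a b u :
  lmod_quot_scale a (lmod_quot_scale b u) = lmod_quot_scale (a * b) u.
Proof. by elim/lmod_quotW: u => x; rewrite !lmod_quot_scaleE scalerA. Qed.

Fact lmod_quot_scale1r : left_id 1 lmod_quot_scale.
Proof. by move=> u; elim/lmod_quotW: u => x; rewrite lmod_quot_scaleE scale1r. Qed.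

Fact lmod_quot_scalerDr : right_distributive lmod_quot_scale +%R.
Proof.
move=> a u v; elim/lmod_quotW: u => x; elim/lmod_quotW: v => y.
by rewrite -lmod_quot_piD !lmod_quot_scaleE scalerDr lmod_quot_piD.
Qed.

Fact lmod_quot_scalerDl u : {morph lmod_quot_scale^~ u : a b / a + b}.
Proof.
by elim/lmod_quotW: u => x a b; rewrite !lmod_quot_scaleE scalerDl lmod_quot_piD.
Qed.

HB.instance Definition _ := GRing.Zmodule_isLmodule.Build R lmod_quot
  lmod_quot_scalerA lmod_quot_scale1r lmod_quot_scalerDr lmod_quot_scalerDl.

Fact lmod_quot_pi_linear : linear (fun x => \pi_lmod_quot x).
Proof. by move=> a x y; rewrite lmod_quot_piD -lmod_quot_scaleE. Qed.

Lemma quotient_module : exists (Q : lmodType R) (p : {linear V -> Q}),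
  (forall q, exists v, q = p v) /\ (forall v, p v = 0 <-> v \in I).
Proof.
pose HC := GRing.isLinear.Build _ _ _ _ _ lmod_quot_pi_linear.
pose p : {linear V -> lmod_quot} := HB.pack (fun x => \pi_lmod_quot x) HC.
exists lmod_quot, p; split=> [q|v]; first by elim/lmod_quotW: q => x; exists x.
rewrite -(linear0 p) -[X in X \in I]subr0.
by split=> [/lmod_quot_eqP|vI] //; apply/lmod_quot_eqP.
Qed.

End QuotientModule.

(** * Quotients of the left module [Af], for [f] a primitive idempotent *)

Section LocalModules.
Variables (k : closedFieldType) (A : falgType k).

Lemma fin_dim_quotient (Q : lmodType A) (p : {linear A^o -> Q}) :
  (forall q, exists v, q = p v) -> fin_dim_module Q.
Proof.
move=> surj; exists (\dim {:A}), (fun i => p (vbasis {:A})`_i) => q.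
have [v ->] := surj q; exists (fun i => coord (vbasis {:A}) i v).
rewrite {1}(coord_vbasis (memvf (v : A))) linear_sum; apply: eq_bigr => i _.
by rewrite -linearZ /=; congr (p _); rewrite [RHS]mulr_algl.
Qed.

(** A quotient of [A] by a left ideal [I] containing [1 - f] is a quotient of
    [Af].  In a decomposition of it, the components of the generator [p f] are
    [x *: p f] and [(f - x) *: p f] for some [x] in the local algebra [fAf], and
    one of [x], [f - x] is invertible there. *)
Lemma local_quotient_indecomposable (f : A) (I : submodClosed A^o)
    (Q : lmodType A) (p : {linear A^o -> Q}) :
  primitive_idem f -> (1 - f : A^o) \in I -> (f : A^o) \notin I ->
  (forall q, exists v, q = p v) -> (forall v, p v = 0 <-> v \in I) ->
  indecomposable_module Q.
Proof.
move=> pf fI nfI surj ker; have [nzf ff _] := pf.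
have pZ (a b : A) : p (a * b : A^o) = a *: p b by rewrite -linearZ.
have p1 : p 1 = p f by apply/eqP; rewrite -subr_eq0 -linearB; apply/eqP/ker.
have gen q : exists s : A, q = s *: p f.
  by have [s ->] := surj q; exists s; rewrite -p1 -pZ mulr1.
split.
  by exists (p f); apply: contra nfI => /eqP/ker.
move=> U W UW UW0.
have [u [w [uU wW Ef]]] := UW (p f).
have fpf : f *: p f = p f by rewrite -pZ ff.
have E : f *: u - u = w - f *: w.
  apply/eqP; rewrite subr_eq addrAC eq_sym subr_eq addrC -Ef -fpf Ef scalerDr.
  by rewrite addrC.
have fu : f *: u = u.
  apply/eqP; rewrite -subr_eq0; apply/eqP/UW0; first by rewrite -scaleN1r rpredD ?rpredZ.
  by rewrite E -scaleN1r rpredD ?rpredZ.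
have [s us] := gen u.
pose x := f * s * f.
have fx : f * x = x by rewrite /x !mulrA ff.
have xf : x * f = x by rewrite /x -!mulrA ff.
have ux : u = x *: p f by rewrite -fu us /x -!scalerA fpf.
have [c cJ] := primitive_residue pf fx xf.
have [c0|nzc] := eqVneq c 0.
  left; rewrite c0 scale0r subr0 in cJ.
  have [y yx] := radv_quasireg cJ.
  have fW : p f \in W.
    have -> : p f = y *: w.
      have -> : w = (1 - x) *: p f by rewrite scalerBl scale1r -ux Ef addrC addKr.
      by rewrite scalerA yx scale1r.
    exact: rpredZ.
  move=> u' u'U; apply: UW0 => //; have [s' ->] := gen u'; exact: rpredZ.
right.
have zJ : - (c^-1 *: (x - c *: f)) \in radv A by rewrite rpredN rpredZ.
have [y yx] := radv_quasireg zJ.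
have fU : p f \in U.
  have -> : p f = (y * c^-1%:A) *: u.
    rewrite ux scalerA -pZ; congr (p _).
    rewrite -mulrA mulr_algl.
    have -> : c^-1 *: x = (1 - (- (c^-1 *: (x - c *: f)))) * f.
      rewrite opprK mulrDl mul1r -scalerAl mulrBl xf -scalerAl ff scalerBr.
      by rewrite scalerA mulVf // scale1r addrC subrK.
    by rewrite mulrA yx mul1r.
  exact: rpredZ.
by move=> w' w'W; apply: UW0 => //; have [s' ->] := gen w'; apply: rpredZ.
Qed.

(** An isomorphism between two such quotients is induced by the right
    multiplication by an invertible element [c f + z] of [fAf]. *)
Lemma local_quotient_iso (f : A) (I I' : submodClosed A^o)
    (Q Q' M : lmodType A) (p : {linear A^o -> Q}) (p' : {linear A^o -> Q'}) :
  primitive_idem f ->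
  (1 - f : A^o) \in I -> (1 - f : A^o) \in I' -> (f : A^o) \notin I' ->
  (forall q, exists v, q = p v) -> (forall v, p v = 0 <-> v \in I) ->
  (forall q, exists v, q = p' v) -> (forall v, p' v = 0 <-> v \in I') ->
  isomorphic_modules Q M -> isomorphic_modules Q' M ->
  exists c z, [/\ c != 0, z \in radv A &
    forall x : A, (x : A^o) \in I -> x * f = x -> (c *: x + x * z : A^o) \in I'].
Proof.
move=> pf fI fI' nfI' surj ker surj' ker' [h [h1 h1K hK1]] [g [g1 g1K gK1]].
have [nzf ff _] := pf.
have pZ (a b : A) : p (a * b : A^o) = a *: p b by rewrite -linearZ.
have p'Z (a b : A) : p' (a * b : A^o) = a *: p' b by rewrite -linearZ.
have p1 : p' 1 = p' f by apply/eqP; rewrite -subr_eq0 -linearB; apply/eqP/ker'.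
have [s Es] := surj' (g1 (h (p f))).
have gs : g (p' s) = h (p f) by rewrite -Es gK1.
pose x := f * s * f.
have fx : f * x = x by rewrite /x !mulrA ff.
have xf : x * f = x by rewrite /x -!mulrA ff.
have gx : g (p' x) = h (p f).
  have -> : p' x = f *: p' s.
    by rewrite /x p'Z -p1 -p'Z mulr1 p'Z.
  by rewrite linearZ gs -linearZ -pZ ff.
have Ix v : (v : A^o) \in I -> v * f = v -> (v * x : A^o) \in I'.
  move=> vI vf; apply/ker'; apply: (can_inj g1K).
  by rewrite p'Z linearZ gx -linearZ -pZ vf linear0; move/ker: vI => ->; rewrite linear0.
have [c cJ] := primitive_residue pf fx xf.
have [c0|nzc] := eqVneq c 0; last first.
  exists c, (x - c *: f); split=> // v vI vf.
  by rewrite mulrBr -scalerAr vf addrC subrK Ix.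
rewrite c0 scale0r subr0 in cJ.
have [t Et] := surj (h1 (g (p' f))).
have p1' : p 1 = p f.
  by apply/eqP; rewrite -subr_eq0 -linearB; apply/eqP/ker.
have ptf : p' 1 = p' (t * x).
  apply: (can_inj g1K); rewrite p1 p'Z linearZ gx -linearZ -p1' -pZ mulr1 -Et.
  by rewrite hK1.
have [u ut] := radv_quasireg (radvMl t cJ).
case/negP: nfI'; apply/ker'; rewrite -p1 -ut p'Z.
by rewrite linearB -ptf subrr scaler0.
Qed.

End LocalModules.

(** * The layer [J / J^2] for an algebra of finite representation type *)

Lemma closed_field_distinct (k : closedFieldType) (n : nat) :
  exists c : 'I_n -> k, injective c.
Proof.
suff [s us ss] : exists2 s : seq k, uniq s & size s = n.
  exists (fun i => s`_i) => i j /eqP.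
  by rewrite nth_uniq ?ss // => /eqP/val_inj.
elim: n => [|n [[|c0 s'] us ss]]; first by exists [::].
  by exists [:: 0] => //=; rewrite -ss.
set s := c0 :: s' in us ss.
(* The product vanishes on [s], and takes the value [-1] at a root of [p]. *)
pose p := \prod_(a <- s) ('X - a%:P) + 1.
have /closed_rootP[c rc] : size p != 1%N.
  rewrite size_polyDl size_prod_XsubC ?size_poly1 ?ltnS //.
exists (c :: s); last by rewrite -ss.
rewrite cons_uniq us andbT; apply: contraL rc => cs.
rewrite /root /p hornerD hornerC; suff -> : (\prod_(a <- s) ('X - a%:P)).[c] = 0.
  by rewrite add0r oner_eq0.
by apply/rootP; rewrite root_prod_XsubC.
Qed.

Section RadicalLayer.
Variables (k : closedFieldType) (A : falgType k).
Hypothesis hA : finite_representation_type A.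

(** The component [e (J / J^2) f] has dimension at most one: otherwise the left
    ideals [U c] below define infinitely many indecomposable modules. *)
Lemma finite_rep_layer_dim (e f x y : A) :
    primitive_idem e -> primitive_idem f ->
    x \in radv A -> e * x = x -> x * f = x ->
    y \in radv A -> e * y = y -> y * f = y ->
  exists a b : k, ((a != 0) || (b != 0)) /\ a *: x + b *: y \in (radv A ^+ 2)%VS.
Proof.
move=> pe pf xJ ex xf yJ ey yf; apply: contrapT => nex.
have indep a b : a *: x + b *: y \in (radv A ^+ 2)%VS -> a = 0 /\ b = 0.
  move=> abJ; split; apply: contrapT => /eqP nz; apply: nex; exists a, b.
    by rewrite nz.
  by rewrite nz orbT.
have [[nze ee _] [nzf ff _]] := (pe, pf).
pose z c := x - c *: y.
have zJ c : z c \in radv A by rewrite rpredB ?rpredZ.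
have zf c : z c * f = z c by rewrite mulrBl xf -scalerAl yf.
have ez c : e * z c = z c by rewrite mulrBr ex -scalerAr ey.
pose U c : {vspace A} := (princ (1 - f) + princ (z c) + radv A ^+ 2)%VS.
have lU c : left_ideal (U c).
  by do ?apply: left_ideal_add; try exact: left_ideal_princ; move=> ? ?; apply: radvX_Ml.
have J2J : (radv A ^+ 2 <= radv A)%VS by have := radvX_sub A (leq0n 1); rewrite expv1.
have UP c v : v \in U c ->
    exists a b j, [/\ v = a * (1 - f) + b * z c + j & j \in (radv A ^+ 2)%VS].
  move=> /memv_addP[_ /memv_addP[_ /princP[a ->] [_ /princP[b ->] ->]] [j jJ ->]].
  by exists a, b, j.
have ff0 : (1 - f) * f = 0 by rewrite mulrBl mul1r ff subrr.
have fU c : f \notin U c.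
  apply/negP => /UP[a [b [j [E jJ]]]].
  case/negP: (primitive_notin_radv pf); rewrite -ff {1}E 2!mulrDl -mulrA ff0 mulr0 add0r.
  by rewrite -mulrDl radvMr // rpredD ?radvMl // (subvP J2J).
have f1U c : 1 - f \in U c.
  by apply: (subvP (addvSl _ _)); apply: (subvP (addvSl _ _)); apply: mem_princ.
have zU c : z c \in U c.
  by apply: (subvP (addvSl _ _)); apply: (subvP (addvSr _ _)); apply: mem_princ.
(* Cutting a relation given by [local_quotient_iso] down to [e (J / J^2) f]
   leaves [s (x - c y) = t (x - c' y)], where [t] is the residue of [e b e]. *)
have inj c c' s w : s != 0 -> w \in radv A -> s *: z c + z c * w \in U c' -> c = c'.
  move=> nzs wJ /UP[a [b [j [E jJ]]]].
  have [||t] := @primitive_residue _ _ e (e * b * e) pe.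
  - by rewrite !mulrA ee.
  - by rewrite -!mulrA ee.
  set r := _ - _ => rJ.
  have Er : e * b * z c' = t *: z c' + r * z c'.
    by rewrite /r mulrBl -scalerAl ez -(mulrA _ e) ez addrC subrK.
  have {}E : s *: z c - t *: z c' = r * z c' + e * j * f - z c * w * f.
    have El : e * (s *: z c + z c * w) * f = s *: z c + z c * w * f.
      by rewrite mulrDr mulrDl -scalerAr ez -scalerAl zf (mulrA e) ez.
    have Err : e * (a * (1 - f) + b * z c' + j) * f = e * b * z c' + e * j * f.
      rewrite !(mulrDr e) !(mulrDl _ _ f) -(mulrA e _ f) -(mulrA a) ff0 !mulr0 add0r.
      by rewrite -(mulrA e (b * _)) -(mulrA b) zf mulrA.
    rewrite E Err Er in El.
    have -> : s *: z c = t *: z c' + r * z c' + e * j * f - z c * w * f.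
      by rewrite El addrK.
    by apply/eqP; rewrite subr_eq [X in _ == X]addrC !addrA.
  have /indep[] : (s - t) *: x + (t * c' - s * c) *: y \in (radv A ^+ 2)%VS.
    have -> : (s - t) *: x + (t * c' - s * c) *: y = s *: z c - t *: z c'.
      rewrite /z !scalerBr !scalerBl !scalerA !opprB addrACA [in RHS]addrACA.
      by rewrite [- (t *: x) + _]addrC.
    rewrite E; apply: rpredB; first apply: rpredD.
    - by rewrite expv2 memv_mul.
    - by apply/radvX_Mr/radvX_Ml.
    - by apply: radvX_Mr; rewrite expv2 memv_mul.
  move=> /eqP; rewrite subr_eq0 => /eqP <- /eqP.
  by rewrite -mulrBr mulf_eq0 (negPf nzs) subr_eq0 => /eqP.
have famI c : {I : submodClosed A^o | forall v, ((v : A^o) \in I) = (v \in U c)}.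
  exact/cid/left_ideal_submod.
have famQ c := cid (quotient_module (sval (famI c))).
have famP c := cid (svalP (famQ c)).
have [n [M MP]] := hA.
have famiso c : {i | isomorphic_modules (sval (famQ c)) (M i)}.
  apply/cid/MP.
    exact: fin_dim_quotient (svalP (famP c)).1.
  have [surj ker] := svalP (famP c).
  apply: (local_quotient_indecomposable pf _ _ surj ker);
    by rewrite (svalP (famI c)).
have [cs csI] := closed_field_distinct k n.+1.
have : ~ injective (fun i => sval (famiso (cs i))).
  by move=> /leq_card; rewrite !card_ord ltnn.
apply=> i j; set c := cs i; set c' := cs j => Eij.
apply: csI; rewrite -/c -/c'.
have [surj ker] := svalP (famP c); have [surj' ker'] := svalP (famP c').
have [||||s [w [nzs wJ H]]] := local_quotient_iso pf _ _ _ surj ker surj' ker'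
  (svalP (famiso c)).
- by rewrite (svalP (famI c)).
- by rewrite (svalP (famI c')).
- by rewrite (svalP (famI c')).
- rewrite Eij; exact: (svalP (famiso c')).
apply: (inj c c' s w nzs wJ); rewrite -(svalP (famI c')).
by apply: H => //; rewrite (svalP (famI c)).
Qed.

End RadicalLayer.

(** * Derivations and the radical filtration *)

Section RadicalFiltration.
Variables (k : fieldType) (A : falgType k).
Local Notation J := (radv A).
Implicit Types d : 'End(A).

(** Derivations raising the radical filtration by at least [s + 1]; since
    [J ^+ 0] is the line of [1] and not the whole algebra, the condition on [A]
    is separate, and the one on [J] implies those on the powers of [J]. *)
Definition der_filtered (s : nat) d : Prop :=
  [/\ derivation d, forall x, d x \in (J ^+ s.+1)%VS
    & forall x, x \in J -> d x \in (J ^+ s.+2)%VS].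

Lemma memv_radvX m n x y : x \in (J ^+ m)%VS -> y \in (J ^+ n)%VS ->
  x * y \in (J ^+ (m + n))%VS.
Proof. by move=> xJ yJ; rewrite expvD memv_mul. Qed.

Lemma der_filtered_radvX s d n x : der_filtered s d ->
  x \in (J ^+ n.+1)%VS -> d x \in (J ^+ (n + s).+2)%VS.
Proof.
case=> dM dA dJ; elim: n x => [|n IHn] x; first by rewrite expv1; apply: dJ.
suff /subvP sub : (J ^+ n.+2 <= d @^-1: (J ^+ (n.+1 + s).+2))%VS.
  by move/sub; rewrite memv_preim.
rewrite {1}expvSl; apply/prodvP => j y jJ yJ; rewrite -memv_preim dM rpredD //.
  have := memv_radvX (dJ j jJ) yJ; congr (_ \in (_ ^+ _)%VS).
  by rewrite !addSn !addnS addnC.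
by have := @memv_radvX 1 _ j _; rewrite expv1; apply=> //; apply: IHn.
Qed.

Lemma derivation_commutator d d' :
  derivation d -> derivation d' -> derivation (commutator d d').
Proof.
move=> dM dM' x y; rewrite !commutatorE dM dM'.
rewrite (linearD d) (linearD d') /= !dM !dM' mulrBl mulrBr.
apply/eqP; rewrite subr_eq; apply/eqP.
rewrite [RHS]addrACA (addrA (_ - _)) subrK (addrC (d' x * d y) (x * d' (d y))).
by rewrite (addrA (_ - _)) subrK addrACA (addrC (d' x * d y)).
Qed.

Lemma der_filtered_commutator s d d' : der_filtered s d -> der_filtered s d' ->
  der_filtered s.+1 (commutator d d').
Proof.
move=> Fd Fd'; have [dM dA dJ] := Fd; have [dM' dA' dJ'] := Fd'.
split=> [|x|x xJ]; first exact: derivation_commutator.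
  rewrite commutatorE; apply: rpredB;
    by apply: (subvP (@radvX_sub _ A (s + s).+1 s.+1 _));
       rewrite ?ltnS ?leq_addr // der_filtered_radvX.
rewrite commutatorE; apply: rpredB;
  by apply: (subvP (@radvX_sub _ A (s.+1 + s).+1 s.+2 _));
     rewrite ?ltnS ?addSn ?ltnS ?leq_addr // -addSn der_filtered_radvX // ?dJ ?dJ'.
Qed.

Lemma der_filtered_lin s (c : k) d d' : der_filtered s d -> der_filtered s d' ->
  der_filtered s (c *: d + d').
Proof.
move=> [dM dA dJ] [dM' dA' dJ']; split=> [x y|x|x xJ]; rewrite !add_lfunE !scale_lfunE.
- by rewrite dM dM' mulrDl mulrDr scalerDr -scalerAl -scalerAr addrACA.
- by rewrite rpredD ?rpredZ.
- by rewrite rpredD ?rpredZ ?dJ ?dJ'.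
Qed.

Lemma der_filtered0 s : der_filtered s 0.
Proof.
split=> [x y|x|x xJ]; rewrite !zero_lfunE ?mem0v //.
by rewrite mul0r mulr0 addr0.
Qed.

End RadicalFiltration.

Section SemisimpleLayer.
Variables (k : closedFieldType) (A : falgType k).
Hypothesis hA : finite_representation_type A.
Local Notation J := (radv A).
Implicit Types d : 'End(A).

Lemma derivation_radv_sq d x : derivation d -> (forall x, d x \in J) ->
  x \in (J ^+ 2)%VS -> d x \in (J ^+ 2)%VS.
Proof.
move=> dM dA; suff /subvP sub : (J ^+ 2 <= d @^-1: (J ^+ 2))%VS.
  by move/sub; rewrite memv_preim.
rewrite {1}expv2; apply/prodvP => u v uJ vJ.
by rewrite -memv_preim dM expv2 rpredD ?memv_mul.
Qed.

(** A derivation with values in [J] maps [e J f] to itself modulo [J^2], so it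
    acts on the component [e (J / J^2) f], at most a line, as a scalar. *)
Lemma derivation_peirce_scalar d (e f x : A) :
    derivation d -> (forall x, d x \in J) ->
    primitive_idem e -> primitive_idem f -> e * x = x -> x * f = x ->
    x \in J -> x \notin (J ^+ 2)%VS ->
  exists c, d x - c *: x \in (J ^+ 2)%VS.
Proof.
move=> dM dA pe pf ex xf xJ xJ2; have [[_ ee _] [_ ff _]] := (pe, pf).
have Ed : d x - e * d x * f \in (J ^+ 2)%VS.
  have -> : d x - e * d x * f = d e * x + x * d f.
    rewrite -{1}xf -{1}ex dM dM mulrDl -mulrA xf ex.
    by rewrite addrAC addrK.
  by rewrite expv2 rpredD ?memv_mul.
have [||||||a [b [ab abJ]]] := @finite_rep_layer_dim _ _ hA e f x (e * d x * f) pe pf => //.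
- exact/radvMr/radvMl.
- by rewrite !mulrA ee.
- by rewrite -!mulrA ff.
have nzb : b != 0.
  apply: contraNneq xJ2 => b0; move: ab abJ; rewrite b0 eqxx orbF scale0r addr0 => nza.
  by move/(memvZ a^-1); rewrite scalerA mulVf // scale1r.
exists (- (b^-1 * a)); rewrite scaleNr opprK.
have -> : d x + (b^-1 * a) *: x
    = (d x - e * d x * f) + b^-1 *: (a *: x + b *: (e * d x * f)).
  by rewrite scalerDr !scalerA mulVf // scale1r (addrC (_ *: x)) addrA subrK.
by rewrite rpredD ?memvZ.
Qed.

Lemma derivation_layer_commute d d' :
    derivation d -> derivation d' ->
    (forall x, d x \in J) -> (forall x, d' x \in J) ->
  der_filtered 0 (commutator d d').
Proof.
move=> dM dM' dA dA'; split=> [|x|x xJ]; first exact: derivation_commutator.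
  by rewrite expv1 commutatorE rpredB.
have [T [e [prim orth sum1]]] := @primitive_decomposition k A 1 (mulr1 1).
have ee i : e i * e i = e i by case: (prim i).
have -> : x = \sum_i \sum_j e i * x * e j.
  under eq_bigr do rewrite -mulr_sumr sum1 mulr1.
  by rewrite -mulr_suml sum1 mul1r.
rewrite linear_sum; apply: rpred_sum => i _.
rewrite linear_sum; apply: rpred_sum => j _.
have ey : e i * (e i * x * e j) = e i * x * e j by rewrite !mulrA ee.
have ye : (e i * x * e j) * e j = e i * x * e j by rewrite -!mulrA ee.
have yJ : e i * x * e j \in J by apply/radvMr/radvMl.
move: (e i * x * e j) ey ye yJ => y ey ye yJ.
rewrite /= commutatorE.
have [yJ2|yJ2] := boolP (y \in (J ^+ 2)%VS).
  by rewrite rpredB ?derivation_radv_sq.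
have [c cP] := derivation_peirce_scalar dM dA (prim i) (prim j) ey ye yJ yJ2.
have [c' cP'] := derivation_peirce_scalar dM' dA' (prim i) (prim j) ey ye yJ yJ2.
have -> : d (d' y) - d' (d y) = d (d' y - c' *: y) - d' (d y - c *: y)
    + (c' *: (d y - c *: y) - c *: (d' y - c' *: y)).
  have dZ (g : 'End(A)) t v : g (t *: v) = t *: g v by apply: linearZ.
  rewrite (linearB d) (linearB d') /= !dZ !scalerBr !scalerA (mulrC c c').
  have aux (u v p q r : A) : u - v = u - p - (v - q) + ((p - r) - (q - r)).
    rewrite (opprB q r) (addrA (p - r)) subrK [RHS]addrAC (addrA (u - p)) subrK.
    by rewrite opprB addrA subrK.
  exact: aux.
by rewrite rpredD ?rpredB ?memvZ ?derivation_radv_sq.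
Qed.

End SemisimpleLayer.

(** * The derived series of [HH1rad A] *)

Section Lift.
Variables (k : fieldType) (A : falgType k).

(** If the classes in [S] have representatives satisfying [P], then those in the
    subspace spanned by the brackets of [S] have representatives satisfying [Q],
    provided that [Q] is linear and holds for commutators under [P]. *)
Lemma HH1rad_derived_lift (P Q : 'End(A) -> Prop) (S : HH1rad A -> Prop) :
    Q 0 -> (forall c d d', Q d -> Q d' -> Q (c *: d + d')) ->
    (forall d d', P d -> P d' -> Q (commutator d d')) ->
    (forall z, S z -> exists2 d : derRad A, P d & z = \pi_(lie_quot (inn_ideal A)) d) ->
  forall z, lie_derived S z ->
    exists2 d : derRad A, Q d & z = \pi_(lie_quot (inn_ideal A)) d.
Proof.
move=> Q0 Qlin PQ SP z [n [c [x [y [Sxy ->]]]]].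
have pi0 : \pi_(lie_quot (inn_ideal A)) (0 : derRad A) = 0.
  by rewrite -[0 in LHS](scale0r 0) lie_quot_piZ scale0r.
apply: (big_ind (fun w => exists2 d : derRad A, Q d & w = \pi_(lie_quot (inn_ideal A)) d)).
- by exists 0.
- move=> _ _ [d Qd ->] [d' Qd' ->]; exists (d + d'); last by rewrite lie_quot_piD.
  by have := Qlin 1 _ _ Qd Qd'; rewrite scale1r.
move=> i _; have [/SP[d Pd ->] /SP[d' Pd' ->]] := Sxy i.
exists (c i *: der_lie d d').
  by have := Qlin (c i) _ _ (PQ _ _ Pd Pd') Q0; rewrite addr0.
by rewrite lie_quot_piZ -(@lie_quot_lieE k _ (inn_ideal A)).
Qed.

End Lift.

Theorem corollary4p6 (k : closedFieldType) (A : falgType k)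
    (hA : finite_representation_type A) :
  lie_solvable (HH1rad A).
Proof.
have base (z : HH1rad A) : exists2 d : derRad A,
    derivation d /\ (forall x, der_fun d x \in radv A) &
    z = \pi_(lie_quot (inn_ideal A)) d.
  elim/lie_quotW: z => d; have /der_radP[dM dJ] := der_funP d.
  have [a aP] := @derivation_inner_mod_radv _ _ (der_fun d) dM
    (fun x xJ => (radvP (d x)).2 (dJ x ((radvP x).1 xJ))).
  have innP : amull a - amulr a \in @inner_der _ A.
    by apply/inner_derP; exists a => x; rewrite !(add_lfunE, opp_lfunE, lfunE).
  pose i := DerRad (inner_der_sub innP).
  exists (d - i); first by split=> //; apply: derivation_sub_inner.
  by apply/lie_quot_eqP; rewrite opprB addrC subrK.
have step n (z : HH1rad A) : derived_series n.+1 z -> exists2 d : derRad A,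
    der_filtered n (der_fun d) & z = \pi_(lie_quot (inn_ideal A)) d.
  elim: n z => [|n IHn].
    apply: (@HH1rad_derived_lift _ _
      (fun d => derivation d /\ forall x, d x \in radv A) (der_filtered 0)).
    - exact: der_filtered0.
    - exact: der_filtered_lin.
    - by move=> d d' [dM dA] [dM' dA']; apply: derivation_layer_commute.
    - by move=> z _; apply: base.
  apply: (@HH1rad_derived_lift _ _ (der_filtered n) (der_filtered n.+1)) IHn.
  - exact: der_filtered0.
  - exact: der_filtered_lin.
  - exact: der_filtered_commutator.
have [m Jm] := radv_nilpotent A.
exists m.+1 => z /step[d [_ dA _] ->].
suff -> : d = 0 by rewrite -[0 in LHS](scale0r 0) lie_quot_piZ scale0r.
apply/val_inj/lfunP => x; apply/eqP; rewrite zero_lfunE -memv0 -Jm; exact: dA.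
Qed.
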